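(* Let $t,n$ be natural numbers such that $t>2$, $t<n/2$ and $\gcd(t,n)=1$, and let $K_t=2^{2t}-2^t+1$ be the Kasami exponent. Then $K_t$ is never congruent to $e(t+1,i)$ modulo $2^n-1$ for any $i<n$ with $\gcd(i,n)=1$.
   Context: For natural numbers $l,k$, $e(l,k)=\sum_{j=0}^{l-1}2^{jk}$. *)

(* Defs.v *)
From mathcomp Require Import all_boot.

Set Implicit Arguments.
Unset Strict Implicit.
Unset Printing Implicit Defensive.

Definition e (l k : nat) : nat := \sum_(0 <= j < l) 2 ^ (j * k).

(* The truncated subtraction is exact, since 2 ^ t <= 2 ^ (2 * t). *)
Definition kasami (t : nat) : nat := 2 ^ (2 * t) - 2 ^ t + 1.

(* Main.v *)
Require Import Defs.
From mathcomp Require Import all_boot.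
From mathcomp Require Import zify.

(** Modulo [2 ^ n - 1] the two numbers have binary supports [{0} U [t, 2t - 1]]
    and [{j i mod n | j <= t}], and neither support is all of [0, n - 1], so a
    congruence forces the supports to be equal.  Write [t + k = j_k i] modulo
    [n] with [j_k <= t].  The differences [j_(k+1) - j_k] agree modulo [n] and
    have absolute value at most [t < n / 2], so they are one constant [d <> 0];
    as [t] terms of step [d] fit in [0, t] and [2 < t], [d = 1] or [d = -1].
    Then [i] is [1] or [-1] modulo [n], while neither [1] nor [n - 1] lies in
    the support of the Kasami exponent. *)

(** Parity determines the lowest bit; cancelling it and halving leaves the shifted sequences. *)
Lemma bits_inj (n : nat) (b c : nat -> bool) :
  \sum_(q < n) b q * 2 ^ q = \sum_(q < n) c q * 2 ^ q ->
  forall q, q < n -> b q = c q.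
Proof.
elim: n b c => [|n IHn] b c //.
have shift (a : nat -> bool) :
    \sum_(q < n.+1) a q * 2 ^ q = a 0 + (\sum_(q < n) a q.+1 * 2 ^ q).*2.
  rewrite big_ord_recl /= muln1 -mul2n big_distrr /=; congr (_ + _).
  by apply: eq_bigr => q _; rewrite /bump add1n expnS mulnCA.
rewrite !shift => eq_bc.
have eq0 : b 0 = c 0.
  by move/(congr1 odd): eq_bc; rewrite !oddD !odd_double !addbF !oddb.
move: eq_bc; rewrite eq0 => /addnI/double_inj/(IHn (b \o S) (c \o S)) eqS.
by case=> [|q] //; apply: eqS.
Qed.

Lemma bits_lt (n : nat) (b : nat -> bool) : \sum_(q < n) b q * 2 ^ q < 2 ^ n.
Proof.
elim: n => [|n IHn]; first by rewrite big_ord0.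
rewrite big_ord_recr /= expnS mul2n -addnn -addSn leq_add //.
by case: (b n); rewrite ?mul1n.
Qed.

Lemma bits_of_uniq (n : nat) (s : seq nat) :
    uniq s -> {in s, forall q, q < n} ->
  \sum_(q <- s) 2 ^ q = \sum_(q < n) (val q \in s) * 2 ^ q.
Proof.
move=> s_uniq s_lt.
rewrite -(big_mkord xpredT (fun q => (q \in s) * 2 ^ q)).
rewrite [RHS](eq_bigr (fun q => if q \in s then 2 ^ q else 0)); last first.
  by move=> q _; case: (q \in s); rewrite ?mul1n.
rewrite -big_mkcond /= -[RHS]big_filter; apply/perm_big/uniq_perm => //.
  by rewrite filter_uniq // iota_uniq.
move=> q; rewrite mem_filter mem_index_iota /=.
by case: (boolP (q \in s)) => // /s_lt ->.
Qed.

Lemma expn_mod_period (n m : nat) : 2 ^ m = 2 ^ (m %% n) %[mod 2 ^ n - 1].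
Proof.
rewrite {1}(divn_eq m n) expnD (mulnC _ n) expnM -modnMml.
have eq1 : 2 ^ n = 1 %[mod 2 ^ n - 1].
  by rewrite -[X in X %% _](@subnK 1 (2 ^ n)) ?expn_gt0 // modnDl.
by rewrite -modnXm eq1 modnXm exp1n modnMml mul1n.
Qed.

(** Since [2 ^ n] is 1 modulo [2 ^ n - 1], exponents matter only modulo [n]. When the residues are
    distinct ([multiples_uniq]), the right-hand sum is a binary expansion. *)
Lemma e_mod_period (n l i : nat) :
  e l i = \sum_(q <- [seq j * i %% n | j <- iota 0 l]) 2 ^ q %[mod 2 ^ n - 1].
Proof.
rewrite /e big_map /index_iota subn0 -modn_summ -[RHS]modn_summ.
by congr (_ %% _); apply: eq_bigr => j _; apply: expn_mod_period.
Qed.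

Definition kasami_support (t : nat) : seq nat := 0 :: iota t t.

(** The block of exponents from [t] to [2 * t - 1] is a geometric sum, equal to
    [2 ^ (2 * t) - 2 ^ t]. *)
Lemma kasamiE (t : nat) : kasami t = \sum_(q <- kasami_support t) 2 ^ q.
Proof.
have sum_iota l : \sum_(q <- iota t l) 2 ^ q = 2 ^ (t + l) - 2 ^ t.
  elim: l => [|l IHl]; first by rewrite big_nil addn0 subnn.
  have le_t : 2 ^ t <= 2 ^ (t + l) by rewrite leq_exp2l ?leq_addr.
  by rewrite -addn1 iotaD big_cat big_seq1 IHl addnA addn1 expnS /=; lia.
by rewrite big_cons sum_iota /kasami mul2n addnn addnC.
Qed.

Lemma eqn_mod_mul2r (n i a b : nat) :
  coprime n i -> (a * i == b * i %[mod n]) = (a == b %[mod n]).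
Proof.
move=> co_ni; wlog le_ba : a b / b <= a.
  by move=> IH; case/orP: (leq_total b a) => /IH // ; rewrite eq_sym => ->.
by rewrite !eqn_mod_dvd ?leq_mul2r ?le_ba ?orbT // -mulnBl Gauss_dvdl.
Qed.

Lemma mul_mod_inj (n i a b : nat) :
  coprime n i -> a < n -> b < n -> a * i = b * i %[mod n] -> a = b.
Proof.
by move=> co_ni a_lt b_lt /eqP; rewrite eqn_mod_mul2r // !modn_small // => /eqP.
Qed.

Lemma multiples_uniq (n l i : nat) :
  l <= n -> coprime n i -> uniq [seq j * i %% n | j <- iota 0 l].
Proof.
move=> le_ln co_ni; rewrite map_inj_in_uniq ?iota_uniq // => j k.
by rewrite !mem_iota => j_lt k_lt; apply: mul_mod_inj; rewrite //; lia.
Qed.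

Lemma kasami_support_e (t n i : nat) :
    2 < t -> 2 * t < n -> coprime n i -> kasami t = e t.+1 i %[mod 2 ^ n - 1] ->
  forall q, q < n ->
  (q \in kasami_support t) = (q \in [seq j * i %% n | j <- iota 0 t.+1]).
Proof.
move=> t_gt2 t_lt co_ni; rewrite (e_mod_period n).
set s := map _ _ => eq_ke.
have lt_k : kasami t < 2 ^ n - 1.
  have le1 : 2 ^ (2 * t).+1 <= 2 ^ n by rewrite leq_exp2l.
  have le2 : 2 ^ 1 < 2 ^ t by rewrite ltn_exp2l //; lia.
  have le3 : 2 ^ t <= 2 ^ (2 * t) by rewrite leq_exp2l //; lia.
  by move: le1 le2 le3; rewrite /kasami expnS expn1; lia.
have s_uniq : uniq s by apply: multiples_uniq => //; lia.
have s_lt : {in s, forall q, q < n}.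
  by move=> _ /mapP[j _ ->]; rewrite ltn_mod; lia.
have k_uniq : uniq (kasami_support t).
  by rewrite /= iota_uniq mem_iota andbT; lia.
have k_lt : {in kasami_support t, forall q, q < n}.
  by move=> q; rewrite inE mem_iota; lia.
apply: (@bits_inj n (mem (kasami_support t)) (mem s)).
rewrite -!bits_of_uniq // -kasamiE.
have := bits_lt n (mem s); rewrite -bits_of_uniq //.
move: eq_ke; rewrite modn_small //; set S := bigop _ _ _ => eq_k S_lt.
(* The congruence is an equality unless [S] is the modulus itself, all bits being 1; then [kasami t]
   would be 0, but it is positive. *)
have : S <= 2 ^ n - 1 by lia.
rewrite leq_eqVlt => /orP[/eqP S_eq|S_lt']; last by rewrite modn_small in eq_k.
by move: eq_k; rewrite S_eq modnn /kasami; lia.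
Qed.

(** If [b - a] were at least 2, then [x = y + s * (b - a)] would be at least [2 * s]. It is used
    with [s = t - 1] and [x <= t], where [2 < t] gives [t < 2 * s]. *)
Lemma lin_step_le1 (s x y a b : nat) :
  x + s * a = y + s * b -> x < s.*2 -> b <= a.+1.
Proof.
move=> eq_xy x_lt; rewrite leqNgt; apply/negP => lt_ab.
by have := leq_mul (leqnn s) lt_ab; rewrite !mulnS; lia.
Qed.

Theorem theorem4 (t n : nat) (t_gt2 : 2 < t) (t_lt_half : 2 * t < n)
    (cop_tn : gcdn t n = 1) (i : nat) (lt_in : i < n) (cop_in : gcdn i n = 1) :
  kasami t <> e t.+1 i %[mod 2 ^ n - 1].
Proof.
have co_ni : coprime n i by rewrite coprime_sym; apply/eqP.
move=> /(kasami_support_e _ _ _ t_gt2 t_lt_half co_ni) supp_eq.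
have index k : k < t -> exists2 j, j <= t & j * i = t + k %[mod n].
  move=> k_lt; have tk_lt : t + k < n by lia.
  have : t + k \in kasami_support t by rewrite inE mem_iota; lia.
  rewrite supp_eq // => /mapP[j]; rewrite mem_iota => j_le ->.
  by exists j; [lia | rewrite modn_mod].
(* The multiple [j = 1] puts [i] itself in the support, whereas [1 < t] and [2 * t - 1 < n - 1]. *)
have i_notin : i \notin [:: 1; n.-1].
  apply/negP => i_in; have : i \in kasami_support t.
    rewrite supp_eq //; apply/mapP; exists 1; first by rewrite mem_iota; lia.
    by rewrite mul1n modn_small.
  by move: i_in; rewrite !inE mem_iota; lia.
have [j0 j0_le j0E] : exists2 j, j <= t & j * i = t + 0 %[mod n].
  by apply: index; lia.
have [j1 j1_le j1E] : exists2 j, j <= t & j * i = t + 1 %[mod n].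
  by apply: index; lia.
(* The last equation is [j = j0 + k * (j1 - j0)], written without subtraction. *)
have progression k : k < t ->
    exists j, [/\ j <= t, j * i = t + k %[mod n] & j + k * j0 = j0 + k * j1].
  elim: k => [|k IHk] k_lt; first by exists j0; rewrite !mul0n.
  have [j [j_le jE j_lin]] := IHk (ltnW k_lt).
  have [j' j'_le j'E] := index _ k_lt; exists j'; split=> //.
  suff : j' + j0 = j + j1 by move: j_lin; rewrite !mulSn; clear; lia.
  (* Both sums are at most [2 * t < n], so it suffices to compare their multiples by [i] modulo [n]:
     both are [2 * t + k + 1]. *)
  apply: (mul_mod_inj _ _ _ _ co_ni).
  - by clear - t_lt_half j'_le j0_le; lia.
  - by clear - t_lt_half j_le j1_le; lia.
  rewrite !mulnDl -modnDm j'E j0E -[RHS]modnDm jE j1E !modnDm.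
  by congr (_ %% _); clear; lia.
have t1_lt : t.-1 < t by clear - t_gt2; lia.
have [j [j_le _ j_lin]] := progression _ t1_lt.
have neq_j : j1 != j0.
  apply/eqP => j_eq; move: j1E; rewrite j_eq j0E => /eqP.
  by rewrite eqn_modDl !modn_small //; clear - t_gt2 t_lt_half; lia.
have [j1_eq | j0_eq] : j1 = j0.+1 \/ j0 = j1.+1.
- have le_j1 : j1 <= j0.+1 by apply: lin_step_le1 j_lin _; clear - t_gt2 j_le; lia.
  have le_j0 : j0 <= j1.+1 by apply: lin_step_le1 (esym j_lin) _; clear - t_gt2 j0_le; lia.
  by move: neq_j le_j1 le_j0; clear; lia.
(* Step 1: [t + i] is [t + 1] modulo [n], so [i = 1]. *)
- move: j1E; rewrite j1_eq mulSnr -modnDml j0E modnDml addn0 => /eqP.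
  rewrite eqn_modDl !modn_small // => [/eqP i1|].
    by rewrite i1 inE in i_notin.
  by clear - t_gt2 t_lt_half; lia.
(* Step -1: [t + 1 + i] is [t] modulo [n], so [n] divides [i + 1] and [i = n - 1]. *)
move: j0E; rewrite j0_eq mulSnr -modnDml j1E modnDml -addnA => /eqP.
rewrite eqn_modDl mod0n add1n => /dvdn_leq n_le.
have /eqP in_eq : i == n.-1 by clear - lt_in n_le; lia.
by rewrite in_eq !inE eqxx orbT in i_notin.
Qed.
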